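(* Let $a(x),b(x)\in\mathbb{Z}[x]$ satisfy, as polynomial identities, $a(x)+a(-1-x)=0$, $b(x)-b(-x)=0$, and $b(0)=0$. Let $a_n=a(n)$, $b_n=b(n)$, and let $p_n,q_n$ be the numerators and denominators of the convergents of $\mathrm{PCF}[a_n,b_n]$, i.e. $u_n=a_nu_{n-1}+b_nu_{n-2}$ with $p_{-1}=1,p_0=a_0,q_{-1}=0,q_0=1$. Then for every $n\ge1$ there is an integer $l\ge0$ such that $\frac{n!}{2^l\,\mathrm{LCM}[n]}$ is an integer dividing $\gcd(p_n,q_n)$; equivalently, the odd part of $\frac{n!}{\mathrm{LCM}[n]}$ divides $\gcd(p_n,q_n)$.
   Context: $\mathrm{LCM}[n]$ denotes the least common multiple of $1,2,\dots,n$. $\mathrm{PCF}[a_n,b_n]=a_0+\cfrac{b_1}{a_1+\cfrac{b_2}{a_2+\cdots}}$. *)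

(* Defs.v *)
From mathcomp Require Import all_boot all_order all_algebra.

Set Implicit Arguments.
Unset Strict Implicit.
Unset Printing Implicit Defensive.

Import GRing.Theory.
Local Open Scope ring_scope.

(* The solution of u_n = a_n u_{n-1} + b_n u_{n-2} (n >= 1) with
   u_{-1} = x and u_0 = y, with indices shifted by one so that they are natural
   numbers: [pcf_rec a b x y m] is u_{m-1}. *)
Fixpoint pcf_rec (a b : nat -> int) (x y : int) (m : nat) : int :=
  match m with
  | 0 => x
  | m1.+1 =>
    match m1 with
    | 0 => y
    | m2.+1 => a m1 * pcf_rec a b x y m1 + b m1 * pcf_rec a b x y m2
    end
  end.

Definition pcf_num (a b : nat -> int) (n : nat) : int :=
  pcf_rec a b 1 (a 0) n.+1.

Definition pcf_den (a b : nat -> int) (n : nat) : int :=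
  pcf_rec a b 0 1 n.+1.

Definition LCM (n : nat) : nat := (\big[lcmn/1]_(1 <= i < n.+1) i)%N.

(* Main.v *)
Require Import Defs.
From mathcomp Require Import all_boot all_order all_algebra.
From mathcomp Require Import ring zify.

(* Write b(x) = x^2 c(x) with c even; the recurrence is the product of the
   matrices X(x) = S(x) diag(1, x^2 c(x)), S(x) = [[a(x), 1], [1, 0]], and the
   hypotheses on a and b say that c is even and that x -> -1 - x turns S into
   -s S^T s, where s = diag(1, -1).  For an odd p, the same reflection maps a
   block of p consecutive factors starting at a multiple of p to another such
   block, so the upper left entry of the block (stripped of its last diagonal
   factor) is odd under the reflection and constant modulo p, hence divisible
   by p.  Conjugating by diag(p, 1) and dividing by p, the blocks become the
   factors X'(t) of a pair (S', c') with the same properties, where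
   c'(t) = c(pt).  Iterating gains one factor p per complete block at each scale
   p^k, up to one block per scale, which is the p-adic valuation of
   n!/LCM[n].  The argument only uses that the entries of S and c preserve
   congruences, and this property
   is inherited by f(pt)/p whenever the latter is integral. *)

Set Implicit Arguments.
Unset Strict Implicit.
Unset Printing Implicit Defensive.

Import GRing.Theory.
Local Open Scope ring_scope.

(** * Two-by-two matrices and the signed transpose *)

Section Mx2.
Variable R : comNzRingType.
Implicit Types (A B : 'M[R]_2) (x y z t : R).

Lemma mx2P A B :
  A 0 0 = B 0 0 -> A 0 1 = B 0 1 -> A 1 0 = B 1 0 -> A 1 1 = B 1 1 -> A = B.
Proof.
have ord2P (i : 'I_2) : i = 0 \/ i = 1.
  by case: i => [[|[|//]]] ?; [left | right]; apply: val_inj.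
move=> *; apply/matrixP => i j.
by case: (ord2P i) => ->; case: (ord2P j) => ->.
Qed.

Definition mx2 x y z t : 'M[R]_2 :=
  \matrix_(i, j) (if i == 0 then if j == 0 then x else y
                  else if j == 0 then z else t).

Lemma mx2_entry x y z t :
  (mx2 x y z t 0 0 = x) * (mx2 x y z t 0 1 = y) *
  (mx2 x y z t 1 0 = z) * (mx2 x y z t 1 1 = t).
Proof. by rewrite !mxE. Qed.

Lemma mx2E A : A = mx2 (A 0 0) (A 0 1) (A 1 0) (A 1 1).
Proof. by apply: mx2P; rewrite !mxE. Qed.

Lemma mx2M x y z t x' y' z' t' :
  mx2 x y z t * mx2 x' y' z' t' =
  mx2 (x * x' + y * z') (x * y' + y * t') (z * x' + t * z') (z * y' + t * t').
Proof. by apply: mx2P; rewrite !(mxE, big_ord_recl, big_ord0) /= addr0. Qed.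

Lemma mx2Z k x y z t : k *: mx2 x y z t = mx2 (k * x) (k * y) (k * z) (k * t).
Proof. by apply: mx2P; rewrite !mxE. Qed.

(* [sgtr A] is [s A^T s] with [s = diag(1, -1)]. *)
Definition sgtr A := mx2 (A 0 0) (- A 1 0) (- A 0 1) (A 1 1).

Lemma sgtrM A B : sgtr (A * B) = sgtr B * sgtr A.
Proof.
rewrite [in LHS](mx2E A) [in LHS](mx2E B) mx2M /sgtr mx2M !mxE /=.
by congr mx2; ring.
Qed.

End Mx2.

(** * Congruence-preserving integer functions *)

Definition cpres (f : int -> int) := forall x d, (d %| f (x + d) - f x)%Z.

Definition mx_cpres (F : int -> 'M[int]_2) := forall i j, cpres (fun x => F x i j).

Lemma cpresM f g : cpres f -> cpres g -> cpres (fun x => f x * g x).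
Proof.
move=> hf hg x d.
have ->: f (x + d) * g (x + d) - f x * g x =
  (f (x + d) - f x) * g (x + d) + f x * (g (x + d) - g x) by ring.
by rewrite rpredD // ?(dvdz_mulr _ (hf _ _)) ?(dvdz_mull _ (hg _ _)).
Qed.

Lemma cpres_shift f e : cpres f -> cpres (fun x => f (x + e)).
Proof. by move=> hf x d; rewrite addrAC hf. Qed.

Lemma cpres_horner (f : {poly int}) : cpres (horner f).
Proof.
move=> x d.
have /factor_theorem[q hq] : root (f - f.[x]%:P) x.
  by rewrite rootE !hornerE subrr.
have := congr1 (horner^~ (x + d)) hq; rewrite !hornerE => ->.
by rewrite addrAC subrr add0r dvdz_mull.
Qed.

Lemma mx_cpresM F G : mx_cpres F -> mx_cpres G -> mx_cpres (fun x => F x * G x).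
Proof.
move=> hF hG i j x d; rewrite !mxE -sumrB rpred_sum // => k _.
exact: (cpresM (hF i k) (hG k j)).
Qed.

(** * Products of transfer matrices under reflection *)

Section Transfer.
Variables (S : int -> 'M[int]_2) (c : int -> int).

Definition delta x : 'M[int]_2 := mx2 1 0 0 (x ^+ 2 * c x).

Definition step x := S x * delta x.

Fixpoint steps (x : int) (k : nat) : 'M[int]_2 :=
  if k is k1.+1 then step (x + k1%:Z) * steps x k1 else 1.

(* The rightmost [delta x] is left out so that the reflection [x -> -1 - x]
   reverses the order of the factors exactly. *)
Definition word x k := steps (x + 1) k * S x.

Lemma stepsD x k l : steps x (k + l) = steps (x + k%:Z) l * steps x k.
Proof.
elim: l => [|l IH]; first by rewrite addn0 mul1r.
by rewrite addnS /= IH mulrA PoszD addrA.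
Qed.

Lemma steps_word x k : steps x k.+1 = word x k * delta x.
Proof. by rewrite (stepsD x 1 k) /= addr0 mulr1 /step /word !mulrA. Qed.

Lemma wordS x k : word x k.+1 = step (x + k.+1%:Z) * word x k.
Proof. by rewrite /word /= mulrA -addrA -PoszD add1n. Qed.

Lemma wordSr x k : word x k.+1 = word (x + 1) k * delta (x + 1) * S x.
Proof. by rewrite {1}/word steps_word. Qed.

(** Trades a diagonal factor on the left for one on the right; this clears the incomplete block
    after the last multiple of [p]. *)
Lemma delta_steps x k : exists Z, delta (x + k%:Z) * steps x k = Z * delta x.
Proof.
case: k => [|k]; first by exists 1; rewrite addr0 mulr1 mul1r.
by exists (delta (x + k.+1%:Z) * word x k); rewrite steps_word mulrA.
Qed.

Definition admissible :=
  [/\ mx_cpres S, cpres c, forall x, c (- x) = c x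
    & forall x, S (-1 - x) = - sgtr (S x)].

Hypothesis adm : admissible.

Lemma sgtr_delta x : sgtr (delta x) = delta (- x).
Proof.
case: adm => _ _ hc _.
by rewrite /sgtr /delta !mxE /= oppr0 sqrrN hc.
Qed.

(** Reflection turns each of the [k.+1] factors [S] into minus its [sgtr], which reverses products;
    evenness of [c] matches the [delta] factors. *)
Lemma word_sgtr x k : word (-1 - (x + k%:Z)) k = (-1) ^+ k.+1 *: sgtr (word x k).
Proof.
case: adm => _ _ _ hS; elim: k x => [|k IH] x.
  by rewrite /word /= addr0 !mul1r hS expr1 scaleN1r.
rewrite wordSr wordS (sgtrM (step _)) (sgtrM (S _)) sgtr_delta.
have -> : -1 - (x + k.+1%:Z) + 1 = - (x + k.+1%:Z) by ring.
rewrite hS.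
have -> : word (- (x + k.+1%:Z)) k = (-1) ^+ k.+1 *: sgtr (word x k).
  by rewrite -IH; congr word; lia.
by rewrite mulrN -!scalerAl (exprS _ k.+1) mulN1r scaleNr !mulrA.
Qed.

Lemma mx_cpres_word k : mx_cpres (word^~ k).
Proof.
case: adm => hS hc _ _.
have hdelta : mx_cpres delta.
  have cpresX2 : cpres (fun x => x * x) by apply: cpresM => x d; rewrite addrC addKr.
  move=> i j x d; rewrite !mxE; do 2![case: ifP => _]; rewrite ?subrr //.
  exact: (cpresM cpresX2 hc x d).
elim: k => [|k IH] i j x d; first by rewrite /word /= !mul1r; apply: hS.
rewrite !wordS.
apply: (@mx_cpresM (fun x => step (x + k.+1%:Z)) (word^~ k)) => // {}i {}j.
apply: (@cpres_shift (fun x => step x i j)).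
exact: mx_cpresM.
Qed.

End Transfer.

(* One step of renormalisation: conjugating a block of [p] steps by
   [diag(p, 1)] and dividing it by [p] gives a step of the new pair. *)
Definition renorm_mx (p : nat) S c (t : int) : 'M[int]_2 :=
  let W := word S c (p%:Z * t) p.-1 in
  mx2 (W 0%R 0%R %/ p%:Z)%Z (W 0 1) (W 1 0) (p%:Z * W 1 1).

Definition renorm_fun (p : nat) (c : int -> int) (t : int) : int := c (p%:Z * t).

(** * Renormalisation by an odd [p] *)

Section Renorm.
Variables (p : nat) (S : int -> 'M[int]_2) (c : int -> int).
Hypotheses (p_odd : odd p) (adm : admissible S c).

Let p_gt0 : (0 < p)%N. Proof. by case: p p_odd. Qed.

Lemma block_sgtr t :
  word S c (p%:Z * (-1 - t)) p.-1 = - sgtr (word S c (p%:Z * t) p.-1).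
Proof.
have <- : -1 - (p%:Z * t + p.-1%:Z) = p%:Z * (-1 - t).
  by rewrite mulrBr mulrN1; lia.
rewrite (word_sgtr adm) prednK // -signr_odd p_odd expr1 scaleN1r //.
Qed.

Lemma dvd_block00 t : (p%:Z %| word S c (p%:Z * t) p.-1 0%R 0%R)%Z.
Proof.
set w := word _ _ _ _ 0 0.
have h : word S c (p%:Z * (-1 - t)) p.-1 0 0 = - w by rewrite block_sgtr mxE mx2_entry.
have := mx_cpres_word adm p.-1 0 0 (p%:Z * t) (p%:Z * (-1 - t - t)).
have -> : p%:Z * t + p%:Z * (-1 - t - t) = p%:Z * (-1 - t) by ring.
rewrite h -/w => h2.
have : (p%:Z %| 2%:Z * w)%Z.
  have -> : 2%:Z * w = - (- w - w) by ring.
  by rewrite rpredN; apply: dvdz_trans h2; apply: dvdz_mulr.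
by rewrite Gauss_dvdzr // coprimezE coprimen2.
Qed.

Lemma renorm_admissible : admissible (renorm_mx p S c) (renorm_fun p c).
Proof.
have hp : p%:Z != 0 by rewrite eqz_nat -lt0n.
case: (adm) => _ hc hcN _; split=> [||t|t].
(* The arguments differ by [p * d], and the extra factor [p] pays for the division in the upper left
   entry. *)
- have hw i j x d : (p%:Z * d %|
      word S c (p%:Z * (x + d)) p.-1 i j - word S c (p%:Z * x) p.-1 i j)%Z.
    by rewrite mulrDr; apply: (mx_cpres_word adm).
  have hd i j x d := dvdz_trans (dvdz_mull p%:Z (dvdzz d)) (hw i j x d).
  move=> i j x d.
  rewrite [renorm_mx _ _ _ (x + d) i j]mxE [renorm_mx _ _ _ x i j]mxE.
  do 2![case: ifP => _] => //.
    by rewrite -(dvdz_mul2l hp) mulrBr ![_ * (_ %/ _)%Z]mulrC !divzK ?dvd_block00.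
  by rewrite -mulrBr dvdz_mull.
- move=> x d; rewrite /renorm_fun mulrDr.
  by apply: dvdz_trans (hc _ _); rewrite dvdz_mull.
- by rewrite /renorm_fun mulrN hcN.
rewrite /renorm_mx block_sgtr; have := dvd_block00 t.
set W := word _ _ _ _ => pW; clearbody W.
apply: mx2P; rewrite !mxE /= ?opprK ?mulrN //.
by apply: (mulIf hp); rewrite mulNr !divzK ?rpredN.
Qed.

Lemma block_renorm t :
  steps S c (p%:Z * t) p * mx2 p%:Z 0 0 1 =
  p%:Z *: (mx2 p%:Z 0 0 1 * step (renorm_mx p S c) (renorm_fun p c) t).
Proof.
have := steps_word S c (p%:Z * t) p.-1; rewrite prednK // => ->.
rewrite /step /delta /renorm_mx /renorm_fun /=.
have := dvd_block00 t; set W := word _ _ _ _ => /divzK hW.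
rewrite [in LHS](mx2E W) !mx2M mx2Z -[in LHS]hW.
by congr mx2; ring.
Qed.

Lemma blocks_renorm t k :
  steps S c (p%:Z * t) (p * k) * mx2 p%:Z 0 0 1 =
  p%:Z ^+ k *: (mx2 p%:Z 0 0 1 * steps (renorm_mx p S c) (renorm_fun p c) t k).
Proof.
elim: k => [|k IH]; first by rewrite muln0 /= mul1r mulr1 scale1r.
rewrite mulnS addnC stepsD -mulrA IH -scalerAr mulrA PoszM -mulrDr block_renorm.
by rewrite -scalerAl scalerA -exprSr -mulrA.
Qed.

(** The square in [delta] supplies [p ^ 2], so a scalar [p] comes out; it raises the [m - 1] powers
    gained from complete blocks to [m]. *)
Lemma delta_renorm t :
  delta c (p%:Z * t) * mx2 p%:Z 0 0 1 =
  p%:Z *: (mx2 1 0 0 p%:Z * delta (renorm_fun p c) t).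
Proof. by rewrite /delta /renorm_fun !mx2M mx2Z; congr mx2; ring. Qed.

(* [diag(p, 1)] is only invertible up to the factor [p]; the left factor
   [delta c N], which absorbs it, is what avoids losing a power of [p]. *)
Lemma delta_steps_renorm N : (p <= N)%N -> exists Z V,
  p%:Z *: (delta c N%:Z * steps S c 1 N.-1) = p%:Z ^+ (N %/ p) *:
  (Z * (delta (renorm_fun p c) (N %/ p)%N%:Z *
    steps (renorm_mx p S c) (renorm_fun p c) 1 (N %/ p).-1) * V).
Proof.
move=> pN; set m := (N %/ p)%N.
have m_gt0 : (0 < m)%N by rewrite divn_gt0.
(* Positions 1 to [N - 1] split into those below [p], the [m - 1] complete blocks from [p] to
   [p * m - 1], and the rest. *)
have eqN : N.-1 = (p.-1 + p * m.-1 + N %% p)%N.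
  have := divn_eq N p; rewrite -/m.
  case: m m_gt0 => // m' _ /=; rewrite mulSn mulnC; lia.
have e1 : 1 + p.-1%:Z = p%:Z by lia.
have e2 : 1 + (p.-1 + p * m.-1)%N%:Z = p%:Z * m%:Z.
  rewrite -PoszM -{2}(prednK m_gt0) mulnS; lia.
have [Z hZ] := delta_steps S c (p%:Z * m%:Z) (N %% p).
have e3 : p%:Z * m%:Z + (N %% p)%N%:Z = N%:Z.
  by rewrite -PoszM -PoszD mulnC -divn_eq.
exists (Z * mx2 1 0 0 p%:Z), (mx2 1 0 0 p%:Z * steps S c 1 p.-1).
rewrite eqN !stepsD e2 e1 mulrA -{1}e3 hZ.
have e4 : p%:Z%:A = mx2 p%:Z 0 0 1 * mx2 1 0 0 p%:Z :> 'M[int]_2.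
  by rewrite mx2M; apply: mx2P; rewrite !mxE /= ; ring.
have -> : p%:Z *: (Z * delta c (p%:Z * m%:Z) *
    (steps S c p%:Z (p * m.-1) * steps S c 1 p.-1)) =
  Z * delta c (p%:Z * m%:Z) * (steps S c p%:Z (p * m.-1) *
    (mx2 p%:Z 0 0 1 * mx2 1 0 0 p%:Z) * steps S c 1 p.-1).
  by rewrite -e4 -!(scalerAl, scalerAr) !mulr1.
have := blocks_renorm 1 m.-1; rewrite mulr1 => hB.
rewrite (mulrA (steps S c p%:Z _)) hB -!(scalerAl, scalerAr) !mulrA.
rewrite -(mulrA Z (delta c _)) delta_renorm -!(scalerAl, scalerAr).
rewrite scalerA -exprSr prednK //.
by rewrite !mulrA.
Qed.

End Renorm.

(** * Valuations of factorials and induction over the scales *)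

Lemma logn_fact_div p n : prime p -> (0 < n)%N ->
  logn p n`! = (n %/ p + logn p (n %/ p)`!)%N.
Proof.
move=> p_pr n_gt0; have p_gt1 := prime_gt1 p_pr.
rewrite !logn_fact // big_ltn // expn1 big_add1 /=; congr addn.
under eq_bigr do rewrite expnS divnMA.
have np : (n %/ p < n)%N by rewrite ltn_Pdiv.
rewrite (@big_cat_nat _ _ _ (n %/ p).+1) //= [X in (_ + X)%N]big_nat_cond.
rewrite [X in (_ + X)%N]big1 ?addn0 // => k /andP[/andP[nk _] _]; rewrite divn_small //.
exact: leq_trans nk (ltnW (ltn_expl _ _)).
Qed.

Lemma trunc_log_div p n : (1 < p <= n)%N -> (trunc_log p (n %/ p) < trunc_log p n)%N.
Proof.
case/andP=> p_gt1 pn; apply: trunc_log_max => //; rewrite expnSr.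
apply: leq_trans (leq_divM n p); rewrite leq_mul2r trunc_logP ?orbT //.
by rewrite divn_gt0 // ltnW.
Qed.

(** [n] and [N] are kept apart since the application has [N = n.+1], a relation that division by [p]
    need not preserve. *)
Lemma delta_steps_dvd p S c n N : prime p -> odd p -> admissible S c ->
  (n <= N)%N -> exists Z,
  delta c N%:Z * steps S c 1 N.-1 = p%:Z ^+ (logn p n`! - trunc_log p n) *: Z.
Proof.
move=> p_pr p_odd; have p_gt1 := prime_gt1 p_pr; have p_gt0 := ltnW p_gt1.
elim/ltn_ind: n N S c => n IH N S c adm nN.
case: (ltnP n p) => np.
  exists (delta c N%:Z * steps S c 1 N.-1).
  suff -> : logn p n`! = 0%N by rewrite sub0n expr0 scale1r.
  rewrite logn_fact // big_nat_cond big1 // => k /andP[/andP[k_gt0 _] _].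
  by rewrite divn_small // (leq_trans np) // -{1}[p]expn1 leq_exp2l.
have n_gt0 : (0 < n)%N by apply: leq_trans np.
have [Z [V hZV]] := delta_steps_renorm p_odd adm (leq_trans np nN).
have [|Q hQ] := IH _ (ltn_Pdiv p_gt1 n_gt0) (N %/ p)%N _ _ (renorm_admissible p_odd adm).
  exact: leq_div2r.
set e := (logn p (n %/ p)`! - trunc_log p (n %/ p))%N in hQ.
set f := (logn p n`! - trunc_log p n)%N.
(* Each scale loses one power of [p]; this is covered by [trunc_log], which drops by at least one
   from [n] to [n %/ p]. *)
have hf : (f.+1 <= N %/ p + e)%N.
  have := logn_fact_div p_pr n_gt0; have := @trunc_log_div p n.
  rewrite p_gt1 np => /(_ isT); have := leq_div2r p nN.
  have : (0 < n %/ p)%N by rewrite divn_gt0.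
  rewrite /f /e; lia.
exists (p%:Z ^+ (N %/ p + e - f.+1) *: (Z * Q * V)).
have hp : p%:Z != 0 by rewrite eqz_nat -lt0n.
suff : p%:Z *: (delta c N%:Z * steps S c 1 N.-1) =
       p%:Z *: (p%:Z ^+ f *: (p%:Z ^+ (N %/ p + e - f.+1) *: (Z * Q * V))).
  move=> /matrixP h; apply/matrixP => i j; apply: (mulfI hp).
  by move: (h i j); rewrite [LHS]mxE [RHS]mxE.
rewrite hZV hQ -scalerAr -scalerAl !scalerA -exprS -!exprD subnKC //.
Qed.

(** * Application to the convergents *)

Section PCF.
Variables (a b c : int -> int).
Hypothesis bE : forall x, b x = x ^+ 2 * c x.

Let S x := mx2 (a x) 1 1 0.

(** The column of two consecutive terms is padded with zeros to keep all matrices square. *)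
Lemma pcf_recE (x y : int) n :
  steps S c 1 n * mx2 y 0 x 0 =
  mx2 (pcf_rec (fun k => a k%:Z) (fun k => b k%:Z) x y n.+1) 0
      (pcf_rec (fun k => a k%:Z) (fun k => b k%:Z) x y n) 0.
Proof.
elim: n => [|n IH]; first by rewrite mul1r.
rewrite [steps _ _ _ _]/= -mulrA IH -[1 + n%:Z]/(n.+1%:Z) /step /delta /S !mx2M.
by congr mx2; rewrite /= ?bE; ring.
Qed.

Hypotheses (a_cpres : cpres a) (c_cpres : cpres c).
Hypotheses (a_anti : forall x, a (-1 - x) = - a x).
Hypotheses (c_even : forall x, c (- x) = c x).

Lemma pcf_admissible : admissible S c.
Proof.
split=> // [i j x d|x]; last first.
  by apply: mx2P; rewrite !mxE /= ?opprK ?oppr0 // a_anti.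
by rewrite !mxE; do 2![case: ifP => _] => //; rewrite subrr.
Qed.

Lemma pcf_rec_dvd x y n p : prime p -> odd p ->
  (p%:Z ^+ (logn p n`! - trunc_log p n) %|
   pcf_rec (fun k => a k%:Z) (fun k => b k%:Z) x y n.+1)%Z.
Proof.
move=> p_pr p_odd.
have [Z /(congr1 ( *%R^~ (mx2 y 0 x 0)))] :=
  delta_steps_dvd p_pr p_odd pcf_admissible (leqnSn n).
(* The first row of [delta] is (1, 0), so this left factor preserves the upper left entry. *)
rewrite -mulrA pcf_recE mx2M -scalerAl => /(congr1 (fun A : 'M_2 => A 0 0)).
by rewrite mx2_entry mul1r mul0r addr0 mxE => ->; rewrite dvdz_mulr.
Qed.

End PCF.

(** * Comparison with the least common multiple *)

Lemma LCM_dvd_fact n : (LCM n %| n`!)%N.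
Proof.
rewrite /LCM big_nat_cond; elim/big_ind: _ => [|k l hk hl|k /andP[hk _]].
- exact: dvd1n.
- by rewrite dvdn_lcm hk.
- by rewrite dvdn_fact.
Qed.

Lemma dvd_LCM n k : (0 < k <= n)%N -> (k %| LCM n)%N.
Proof.
case/andP=> k_gt0 kn; rewrite /LCM (bigD1_seq k) ?iota_uniq ?mem_index_iota ?k_gt0 //=.
exact: dvdn_lcml.
Qed.

(** For [n > 0] the power [p ^ trunc_log p n] is at most [n], so it divides [LCM n]. *)
Lemma logn_fact_LCM p n : prime p ->
  (logn p (n`! %/ LCM n) <= logn p n`! - trunc_log p n)%N.
Proof.
move=> p_pr; rewrite logn_div ?LCM_dvd_fact // leq_sub2l //.
case: n => [|n]; first by rewrite trunc_log0.
have L_gt0 := dvdn_gt0 (fact_gt0 n.+1) (LCM_dvd_fact n.+1).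
rewrite -pfactor_dvdn // dvd_LCM // expn_gt0 prime_gt0 //=.
by rewrite trunc_logP ?prime_gt1.
Qed.

Lemma even_poly_factor (R : idomainType) (b : {poly R}) :
  (2%:R != 0 :> R) -> b \Po (- 'X) = b -> b.[0] = 0 ->
  exists c, b = 'X^2 * c /\ c \Po (- 'X) = c.
Proof.
move=> two_neq0 b_even b0.
have X_neq0 : 'X != 0 :> {poly R} by rewrite polyX_eq0.
have /factor_theorem[b1] : root b 0 by rewrite rootE b0.
rewrite subr0 => eb.
have b1_odd : b1 \Po (- 'X) = - b1.
  apply: (mulIf X_neq0); rewrite mulNr -eb -[in RHS]b_even eb comp_polyM comp_polyX.
  by rewrite mulrN opprK.
(* Oddness of [b1] makes its value at 0 its own negative, hence zero, which yields the second factor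
   ['X]. *)
have /factor_theorem[c] : root b1 0.
  have := congr1 (horner^~ 0) b1_odd.
  rewrite horner_comp !hornerE oppr0 => /eqP.
  by rewrite -subr_eq0 opprK -mulr2n -mulr_natl mulf_eq0 (negPf two_neq0).
rewrite subr0 => eb1; exists c; split; first by rewrite eb eb1 -mulrA mulrC.
apply: (mulIf X_neq0); apply: oppr_inj.
by rewrite -eb1 -b1_odd eb1 comp_polyM comp_polyX mulrN.
Qed.

Theorem theorem5 (a b : {poly int})
    (ha : a + (a \Po (-1 - 'X)) = 0)
    (hb : b - (b \Po (- 'X)) = 0)
    (hb0 : b.[0] = 0)
    (n : nat) (hn : (1 <= n)%N) :
  let p := pcf_num (fun k => a.[k%:Z]) (fun k => b.[k%:Z]) n in
  let q := pcf_den (fun k => a.[k%:Z]) (fun k => b.[k%:Z]) n in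
  (exists l : nat,
      (2 ^ l * LCM n %| n`!)%N
      /\ ((n`! %/ (2 ^ l * LCM n))%N%:Z %| gcdz p q)%Z)
  /\ (((n`! %/ LCM n)`_2^')%N%:Z %| gcdz p q)%Z.
Proof.
move=> P Q.
have L_dvd := LCM_dvd_fact n.
have m_gt0 : (0 < n`! %/ LCM n)%N.
  by rewrite divn_gt0 ?(dvdn_gt0 _ L_dvd) ?fact_gt0 // dvdn_leq ?fact_gt0.
have main : (((n`! %/ LCM n)`_2^')%N%:Z %| gcdz P Q)%Z.
  have [|c [bE c_even]] := even_poly_factor (isT : 2%:R != 0 :> int) _ hb0.
    by apply/esym/subr0_eq.
  have bkE k : b.[k] = k ^+ 2 * c.[k] by rewrite bE !hornerE.
  have a_anti x : a.[-1 - x] = - a.[x].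
    have := congr1 (horner^~ x) ha; rewrite hornerD horner_comp !hornerE => /eqP.
    by rewrite addrC addr_eq0 => /eqP.
  have c_evenx x : c.[- x] = c.[x] by rewrite -{2}c_even horner_comp !hornerE.
  have rec_dvd := pcf_rec_dvd bkE (@cpres_horner a) (@cpres_horner c) a_anti c_evenx.
  apply/dvdn_partP => [|p]; rewrite ?part_gt0 // => p_pi.
  move: p_pi; rewrite pi_of_part // => /andP[/= p_m p_neq2].
  have p_pr : prime p by move: p_m; rewrite mem_primes => /andP[].
  have p_odd : odd p by case: (even_prime p_pr) p_neq2 => [->|].
  rewrite -[((_ `_ p) %| _)%N]/(((((n`! %/ LCM n)`_2^')`_p)%N%:Z %| gcdz P Q)%Z).
  apply: (@dvdz_trans (p%:Z ^+ (logn p n`! - trunc_log p n))).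
    rewrite p_part dvdzE abszX dvdn_exp2l //; apply: leq_trans (logn_fact_LCM n p_pr).
    by rewrite dvdn_leq_log // dvdn_part.
  by rewrite dvdz_gcd !rec_dvd.
(* With [l] the 2-adic valuation of the quotient, dividing by [2 ^ l] leaves exactly its odd
   part. *)
split=> //; exists (logn 2 (n`! %/ LCM n)); rewrite -p_part.
have e : ((n`! %/ LCM n)`_2 * LCM n * (n`! %/ LCM n)`_2^' = n`!)%N.
  by rewrite mulnAC partnC // divnK.
split; first by rewrite -{2}e dvdn_mulr.
by rewrite -{1}e mulKn // muln_gt0 part_gt0 (dvdn_gt0 _ L_dvd) ?fact_gt0.
Qed.
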